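(* Let $p>3$ be a prime, let $a\in\mathbb{Z}_p$ with $a\not\equiv 0\pmod p$, let $\langle a\rangle_p$ be the least nonnegative residue of $a$ modulo $p$, and let $t=(a-\langle a\rangle_p)/p$. Then $$\sum_{k=0}^{(p-1)/2}\frac{\binom ak\binom{-1-a}k}{2k-1}\equiv\begin{cases}2pt-(2a+1)\sum_{k=0}^{p-1}\binom{2a}k(-2)^k\pmod{p^2}&\text{if }\langle a\rangle_p<\frac p2,\\ 2p(t+1)-\frac{2a+1}{2t+1}-(2a+1)\big(1+\frac1{2t+1}\big)\sum_{k=0}^{p-1}\binom{2a}k(-2)^k\pmod{p^2}&\text{if }\langle a\rangle_p>\frac p2\text{ and }t\not\equiv-\frac12\pmod p,\\ 2a+1+p\big(1+(2a+1)E_{p-2}(-2a)\big)\pmod{p^2}&\text{if }\langle a\rangle_p>\frac p2\text{ and }t\equiv-\frac12\pmod p.\end{cases}$$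
   Context: $\mathbb{Z}_p$ denotes the set of rational numbers whose denominator is not divisible by $p$; congruences modulo $p^m$ are taken in $\mathbb{Z}_p$. For $a\in\mathbb{Z}_p$, $\langle a\rangle_p\in\{0,1,\dots,p-1\}$ satisfies $\langle a\rangle_p\equiv a\pmod p$. $\binom xk=x(x-1)\cdots(x-k+1)/k!$. The Euler numbers are defined by $E_0=1$, $E_n=-\sum_{k=1}^{[n/2]}\binom n{2k}E_{n-2k}$ ($n\ge1$), and the Euler polynomials by $E_n(x)=2^{-n}\sum_{r=0}^n\binom nr(2x-1)^{n-r}E_r$. *)

(* Defs.v *)
From HB Require Import structures.
From mathcomp Require Import all_boot all_order all_algebra.
From mathcomp Require Import ring.

Set Implicit Arguments.
Unset Strict Implicit.
Unset Printing Implicit Defensive.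

Import Order.TTheory GRing.Theory Num.Theory.
Local Open Scope ring_scope.

(* The ring Z_p of p-integral rationals (the localization, not the p-adics);
   [denq] is the positive denominator in lowest terms. *)
Definition Zloc (p : nat) : pred rat := [pred x | ~~ (p %| `|denq x|)%N].

(* x = y (mod p^m) in Z_p, i.e. x - y lies in p^m Z_p. *)
Definition congZ (p m : nat) (x y : rat) : bool :=
  (x - y) / (p ^ m)%:R \in Zloc p.

(* The least natural number r < p with a = r (mod p); when a is in Z_p it exists
   by [lresP] below. *)
Definition lres (p : nat) (a : rat) : nat :=
  find (fun r : nat => congZ p 1 a r%:R) (iota 0 p).

Definition binq (x : rat) (k : nat) : rat :=
  (\prod_(i < k) (x - i%:R)) / k`!%:R.

(* [:: E_0; ...; E_(n-1)] *)
Fixpoint euler_seq (n : nat) : seq rat :=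
  if n is m.+1 then
    let s := euler_seq m in
    rcons s (if m == 0%N then 1
             else - \sum_(1 <= k < (m./2).+1) 'C(m, 2 * k)%:R * s`_(m - 2 * k))
  else [::].

Definition euler_number (n : nat) : rat := (euler_seq n.+1)`_n.

Definition euler_poly (n : nat) : {poly rat} :=
  2 ^- n *: \sum_(r < n.+1)
     ('C(n, r)%:R * euler_number r) *: (2 *: 'X - 1) ^+ (n - r).

Lemma size_euler_seq n : size (euler_seq n) = n.
Proof. by elim: n => //= n IHn; rewrite size_rcons IHn. Qed.

Lemma nth_euler_seq n i : (i < n)%N -> (euler_seq n)`_i = euler_number i.
Proof.
elim: n => // n IHn; rewrite ltnS leq_eqVlt => /predU1P[-> //|lt_in].
by rewrite /= nth_rcons size_euler_seq lt_in IHn.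
Qed.

Lemma euler_number0 : euler_number 0 = 1.
Proof. by []. Qed.

Lemma euler_numberE n : (0 < n)%N ->
  euler_number n =
  - \sum_(1 <= k < (n./2).+1) 'C(n, 2 * k)%:R * euler_number (n - 2 * k).
Proof.
move=> n_gt0; rewrite /euler_number /= nth_rcons size_euler_seq ltnn eqxx.
rewrite gtn_eqF //; congr (- _); apply: eq_big_nat => k /andP[k_gt0 _].
by rewrite nth_euler_seq // ltn_subrL n_gt0 muln_gt0 k_gt0.
Qed.

Lemma Zloc_mul (p d : nat) (x : rat) (m : int) :
  (1 < p)%N -> coprime p d -> x * d%:Z%:~R = m%:~R -> x \in Zloc p.
Proof.
move=> p_gt1 co_pd xd; rewrite inE; apply/negP => dvd_p.
have numden : numq x * d = m * denq x.
  by apply/eqP; rewrite -(@eqr_int rat) !intrM -xd numqE mulrAC.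
have : (`|denq x| %| d)%N.
  rewrite -(@Gauss_dvdr _ `|numq x|) 1?coprime_sym ?coprime_num_den //.
  by have /(congr1 absz) := numden; rewrite !abszM /= => ->; rewrite dvdn_mull.
move/(dvdn_trans dvd_p)/gcdn_idPl => gp.
by move: co_pd; rewrite /coprime gp gtn_eqF.
Qed.

Lemma lresP p a : prime p -> a \in Zloc p ->
  (lres p a < p)%N /\ congZ p 1 a (lres p a)%:R.
Proof.
move=> p_pr aZ; have p_gt1 := prime_gt1 p_pr; have p_gt0 := prime_gt0 p_pr.
have has_r : has (fun r : nat => congZ p 1 a r%:R) (iota 0 p).
  have co : coprime p `|denq a| by rewrite prime_coprime.
  have d_gt0 : (0 < `|denq a|)%N by rewrite absz_gt0 denq_neq0.
  have dE : (`|denq a|%N : int) = denq a by rewrite absz_denq.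
  have pZ0 : (p : int) != 0 by rewrite -lt0n.
  have /coprimezP[[u v] /= uv] : coprimez p (denq a) by [].
  pose r := (v * numq a %% p)%Z.
  have r_ge0 : 0 <= r by rewrite modz_ge0.
  have r_lt : r < p by rewrite ltz_pmod // ltz_nat.
  apply/hasP; exists `|r|%N.
    by rewrite mem_iota /= add0n -ltz_nat gez0_abs.
  rewrite /congZ expn1.
  have -> : (`|r|%N%:R : rat) = r%:~R by rewrite -[RHS](congr1 _ (gez0_abs r_ge0)).
  have [q qE] : exists q : int, numq a - r * denq a = q * p.
    exists (u * numq a + (v * numq a %/ p)%Z * denq a).
    have := divz_eq (v * numq a) p; rewrite -/r => e.
    have -> : r = v * numq a - (v * numq a %/ p)%Z * p.
      by rewrite {1}e addrC addKr.
    by rewrite -{1}[numq a]mul1r -uv; ring.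
  apply: (@Zloc_mul p `|denq a| _ q) => //.
  have p0 : (p%:Z%:~R : rat) != 0 by rewrite intr_eq0.
  rewrite dE -[p%:R]/(p%:Z%:~R) mulrAC mulrBl -numqE.
  by rewrite -intrM -intrB qE intrM mulfK.
have lt_r : (lres p a < p)%N by rewrite -[X in (_ < X)%N](size_iota 0 p) -has_find.
by split=> //; have := nth_find 0%N has_r; rewrite nth_iota.
Qed.

(* Main.v *)
(** Write f(a) for the left-hand sum (with n = (p-1)/2) and T(x) for
    sum_(k < p) C(x, k) (-2)^k. Both satisfy first-order recurrences,
      (2a-1) f(a) - (2a+1) f(a-1) = 2 C(a-1, n) C(-1-a, n),
      T(x+1) + T(x) = 2^p C(x, p-1),
    whose right-hand sides are explicit modulo p^2. Starting from a = pt, where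
    f and T are given modulo p^2 by 2^p - 2, the combination
    f(a) - 2pt + (2a+1) T(2a) is therefore 0 modulo p^2 for a = pt + i with
    0 <= i <= n: this is the first case. If <a>_p > p/2, the symmetry
    f(a) = f(-1-a) brings the argument back to this range and leaves T(-2-2a).
    With x = 2a = s + pu, where u = 2t+1, the recurrence for T shows
      (x+1) (u T(-2-x) + (u+1) T(x) - (-1)^s) = 2pu(u+1)  (mod p^2),
    which gives the second case. When p divides u, the Euler polynomials enter
    because E_(p-2)(x+1) + E_(p-2)(x) = 2 x^(p-2) is 2/x modulo p, so that
    T(-2-x) and p E_(p-2)(-x) obey matching recurrences. *)

Require Import Defs.
From HB Require Import structures.
From mathcomp Require Import all_boot all_order all_algebra.
From mathcomp Require Import ring lra zify.

Set Implicit Arguments.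
Unset Strict Implicit.
Unset Printing Implicit Defensive.

Import Order.TTheory GRing.Theory Num.Theory.
Local Open Scope ring_scope.

(** * Binomial coefficients with rational upper argument *)

Lemma binq0 x : binq x 0 = 1.
Proof. by rewrite /binq big_ord0 fact0 divr1. Qed.

Lemma natS_neq0 k : 1 + k%:R != 0 :> rat.
Proof. by rewrite addrC natr1 pnatr_eq0. Qed.

Lemma binqS (x : rat) k : binq x k.+1 = binq x k * (x - k%:R) / k.+1%:R.
Proof.
rewrite /binq big_ord_recr /= factS natrM; field.
by rewrite natS_neq0 pnatr_eq0 -lt0n fact_gt0.
Qed.

Lemma binq_absorb (x : rat) k : binq x k.+1 = x / k.+1%:R * binq (x - 1) k.
Proof.
elim: k => [|k IHk]; first by rewrite binqS !binq0; field.
rewrite binqS IHk (binqS (x - 1)) -!natr1; field.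
by rewrite addrAC !natr1 !pnatr_eq0.
Qed.

(** Both sides are (k+1) C(x, k+1). The form without division allows shifting the upper argument
    even where x or x - k is divisible by p. *)
Lemma binq_pred_mul (x : rat) k : x * binq (x - 1) k = (x - k%:R) * binq x k.
Proof.
have k0 : k.+1%:R != 0 :> rat by rewrite pnatr_eq0.
apply: (mulIf (invr_neq0 k0)).
by rewrite mulrAC -binq_absorb binqS [(x - _) * _]mulrC.
Qed.

Lemma predn_natr k : (0 < k)%N -> k.-1%:R = k%:R - 1 :> rat.
Proof. by case: k => // k _; rewrite -natr1 addrK. Qed.

Lemma binq_pascal (x : rat) k : binq (x + 1) k.+1 = binq x k.+1 + binq x k.
Proof.
by rewrite binq_absorb addrK binqS -natr1; field; rewrite natr1 pnatr_eq0.
Qed.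

Lemma binq_nat n k : binq n%:R k = 'C(n, k)%:R.
Proof.
elim: n k => [|n IHn] [|k]; rewrite ?binq0 ?bin0 //.
  by rewrite binq_absorb mul0r mul0r bin0n.
by rewrite -natr1 binq_pascal !IHn binS natrD.
Qed.

(** * The sums T and f and their recurrences *)

Definition pow2_sum n x : rat := \sum_(0 <= k < n) binq x k * (- 2) ^+ k.

(** By Pascal's rule C(x, k) enters the sum at x + 1 with weight (-2)^k + (-2)^(k+1) = -(-2)^k,
    cancelling the sum at x; only k = n lacks its second weight. *)
Lemma pow2_sum_recr n (x : rat) :
  pow2_sum n.+1 (x + 1) + pow2_sum n.+1 x = - binq x n * (- 2) ^+ n.+1.
Proof.
rewrite /pow2_sum.
elim: n => [|n IHn]; first by rewrite !big_nat1 !binq0 !expr0 expr1; ring.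
rewrite big_nat_recr //= [X in _ + X]big_nat_recr //= addrACA IHn binq_pascal.
by rewrite !exprS; ring.
Qed.

(** The products C(x, k) C(-1-x, k) are the coefficients of the Legendre function P_x(1 - 2z) in
    powers of z. *)
Definition legendre_sum n x : rat :=
  \sum_(0 <= k < n.+1) binq x k * binq (- 1 - x) k / (2 * k%:R - 1).

Lemma legendre_sumC n (x : rat) : legendre_sum n (- 1 - x) = legendre_sum n x.
Proof.
rewrite /legendre_sum opprB addrCA subrr addr0; apply: eq_bigr => k _.
by rewrite [binq _ k * _]mulrC.
Qed.

Lemma odd_neq0 (k : nat) : 2 * k%:R - 1 != 0 :> rat.
Proof. by rewrite subr_eq0 -natrM pnatr_eq1; lia. Qed.

(** The sum telescopes: the k-th term on the left is the difference of the right-hand side at k and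
    at k - 1. *)
Lemma legendre_sum_recr n (x : rat) :
  (2 * x - 1) * legendre_sum n x - (2 * x + 1) * legendre_sum n (x - 1)
  = 2 * binq (x - 1) n * binq (- 1 - x) n.
Proof.
have -> : legendre_sum n (x - 1) =
    \sum_(0 <= k < n.+1) binq (x - 1) k * binq (- x) k / (2 * k%:R - 1).
  by rewrite /legendre_sum opprB addrA addNr add0r.
rewrite /legendre_sum; elim: n => [|n IHn].
  by rewrite !big_nat1 !binq0 mulr0 sub0r invrN1; ring.
rewrite big_nat_recr //= [X in _ - _ * X]big_nat_recr //= !mulrDr opprD addrACA.
rewrite {}IHn; set c := 2 * n.+1%:R - 1.
have cE : c = 2 * n%:R + 1 by rewrite /c -natr1; ring.
have c0 : 2 * n%:R + 1 != 0 :> rat by rewrite -cE odd_neq0.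
rewrite (binq_absorb x) (binq_absorb (- x)) !(binqS (x - 1)) !(binqS (- 1 - x)).
rewrite [- x - 1]addrC cE -natr1; field.
by rewrite c0 natS_neq0.
Qed.

(** * Rearranged sums and the functional equation of Euler polynomials *)

Lemma sum_pairs (F : nat -> rat) m :
  \sum_(1 <= k < m.+1) (F (2 * k - 1)%N + F (2 * k)%N)
  = \sum_(1 <= j < m.*2.+1) F j.
Proof.
elim: m => [|m IHm]; first by rewrite !big_geq.
rewrite big_nat_recr //= IHm doubleS [RHS]big_nat_recr //=.
rewrite [X in _ = X + _]big_nat_recr //= addrA.
by congr (_ + F _ + F _); lia.
Qed.

Lemma sum_even (G : nat -> rat) m :
  \sum_(0 <= k < m.+1) G k * (1 + (- 1) ^+ k)
  = 2 * \sum_(0 <= k < m./2.+1) G (2 * k)%N.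
Proof.
elim: m => [|m IHm]; first by rewrite !big_nat1 expr0 mulrC.
rewrite big_nat_recr //= IHm -signr_odd /= uphalf_half.
case: (boolP (odd m)) => om; last by rewrite expr1 subrr mulr0 addr0.
rewrite [in RHS]big_nat_recr //= [RHS]mulrDr; congr (_ + _).
rewrite expr0 mulrC (_ : (2 * _)%N = m.+1) //.
by rewrite add1n mul2n doubleS -[in RHS](odd_double_half m) om.
Qed.

(** This is 2^n E_n((z + 1)/2); in the variable z the points x and x + 1 become 2x - 1 and 2x + 1,
    symmetric about 2x. *)
Definition euler_sum n z : rat :=
  \sum_(r < n.+1) 'C(n, r)%:R * euler_number r * z ^+ (n - r).

Lemma horner_euler_poly n x :
  (euler_poly n).[x] = 2 ^- n * euler_sum n (2 * x - 1).
Proof.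
rewrite /euler_poly hornerZ horner_sum; congr (_ * _); apply: eq_bigr => i _.
by rewrite hornerZ horner_exp !hornerE.
Qed.

(** Only the E_(n-k) with k even survive the addition, and they form twice the defining recurrence
    of E_n. *)
Lemma euler_sum_pm1 n : euler_sum n 1 + euler_sum n (- 1) = 2 * (n == 0%N)%:R.
Proof.
rewrite /euler_sum -big_split /= -(big_mkord xpredT (fun r =>
  'C(n, r)%:R * euler_number r * 1 ^+ (n - r)
  + 'C(n, r)%:R * euler_number r * (- 1) ^+ (n - r))).
rewrite big_nat_rev /= add0n big_nat.
transitivity (\sum_(0 <= k < n.+1)
    ('C(n, k)%:R * euler_number (n - k)) * (1 + (- 1) ^+ k)).
  rewrite [RHS]big_nat; apply: eq_bigr => k; rewrite ltnS => lekn.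
  by rewrite subSS bin_sub // subKn // expr1n -mulrDr.
rewrite (sum_even (fun k => 'C(n, k)%:R * euler_number (n - k))).
rewrite big_ltn // bin0 mul1r subn0; case: n => [|n].
  by rewrite big_geq // addr0.
by rewrite {1}euler_numberE // addNr !mulr0.
Qed.

Lemma exprDn_widen (x y : rat) m N : (m <= N)%N ->
  (x + y) ^+ m = \sum_(j < N.+1) 'C(m, j)%:R * x ^+ j * y ^+ (m - j).
Proof.
move=> lemN; rewrite addrC exprDn.
rewrite (big_ord_widen N.+1 (fun i => (y ^+ (m - i) * x ^+ i) *+ 'C(m, i))) //.
rewrite big_mkcond; apply: eq_bigr => i _; rewrite ltnS.
case: leqP => [_|lt]; last by rewrite bin_small // !mul0r.
by rewrite -mulr_natl; ring.
Qed.

(** Both products are n!/(r! j! (n-r-j)!), or 0 when r + j > n. *)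
Lemma bin_mul_swap n r j :
  ('C(n, r) * 'C(n - r, j) = 'C(n, j) * 'C(n - j, r))%N.
Proof.
case: (leqP (r + j) n) => [le|lt]; last first.
  have zero a b : (n < a + b)%N -> ('C(n, a) * 'C(n - a, b) = 0)%N.
    move=> ltn; case: (leqP a n) => lea; last by rewrite bin_small.
    by rewrite [X in (_ * X)%N]bin_small ?muln0 // ltn_subLR.
  by rewrite !zero // addnC.
apply/eqP; rewrite -(eqn_pmul2r (fact_gt0 r)) -(eqn_pmul2r (fact_gt0 j)).
rewrite -(eqn_pmul2r (fact_gt0 (n - r - j))); apply/eqP.
have ler : (r <= n)%N by apply: leq_trans (leq_addr _ _) le.
have lej : (j <= n)%N by apply: leq_trans (leq_addl _ _) le.
transitivity n`!.
  rewrite -(bin_fact ler) -(@bin_fact (n - r) j) ?leq_subRL //; ring.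
rewrite -(bin_fact lej) -(@bin_fact (n - j) r) ?leq_subRL // 1?addnC //.
by rewrite subnAC; ring.
Qed.

(** The Appell property: expand (z + h)^(n-r), exchange the sums and regroup the coefficients by
    [bin_mul_swap]. *)
Lemma euler_sumD n z h :
  euler_sum n (z + h)
  = \sum_(j < n.+1) 'C(n, j)%:R * z ^+ j * euler_sum (n - j) h.
Proof.
pose F r j := ('C(n, r) * 'C(n - r, j))%:R * euler_number r
  * z ^+ j * h ^+ (n - r - j).
transitivity (\sum_(r < n.+1) \sum_(j < n.+1) F r j).
  apply: eq_bigr => r _; rewrite (exprDn_widen _ _ (leq_subr r n)) mulr_sumr.
  by apply: eq_bigr => j _; rewrite /F natrM; ring.
rewrite exchange_big; apply: eq_bigr => j _; rewrite /euler_sum.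
rewrite (big_ord_widen n.+1 (fun r =>
  'C(n - j, r)%:R * euler_number r * h ^+ (n - j - r))); last first.
  by rewrite ltnS leq_subr.
rewrite [in RHS]big_mkcond mulr_sumr; apply: eq_bigr => r _; rewrite /F ltnS.
rewrite bin_mul_swap natrM; case: leqP => [_|lt]; last first.
  by rewrite (bin_small lt); ring.
by rewrite subnAC; ring.
Qed.

(** Expanding about z = 2x with h = 1 and h = -1, [euler_sum_pm1] leaves only the term in z^n. *)
Lemma euler_poly_step n x :
  (euler_poly n).[x + 1] + (euler_poly n).[x] = 2 * x ^+ n.
Proof.
rewrite !horner_euler_poly -mulrDr.
rewrite (_ : 2 * (x + 1) - 1 = 2 * x + 1); last by ring.
rewrite !euler_sumD -big_split /= big_ord_recr /= big1 => [|j _]; last first.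
  by rewrite -mulrDr euler_sum_pm1 subn_eq0 leqNgt ltn_ord !mulr0.
rewrite add0r -mulrDr euler_sum_pm1 subnn binn eqxx exprMn mul1r mulr1.
by rewrite -mulrA mulKf ?expf_neq0 // mulrC.
Qed.

(** * The ring Z_p and its ideals p^m Z_p *)

Section PIntegral.

Variables (p : nat) (p_pr : prime p).

Notation P := (p%:R : rat).

Let p_gt1 : (1 < p)%N := prime_gt1 p_pr.

(** Any denominator prime to p is accepted, reduced or not, so closure under differences and
    products is immediate. *)
Lemma ZlocP x :
  reflect (exists2 d : nat, coprime p d & exists m : int, x * d%:R = m%:~R)
          (x \in Zloc p).
Proof.
apply: (iffP idP) => [|[d co_pd [m xd]]]; last exact: (Zloc_mul p_gt1 co_pd xd).
rewrite inE -prime_coprime // => co_pd; exists `|denq x|%N => //.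
by exists (numq x); rewrite -[_%:R]/(`|denq x|%N%:Z%:~R) absz_denq -numqE.
Qed.

Fact Zloc_subring_closed : subring_closed (Zloc p).
Proof.
split.
- by apply/ZlocP; exists 1%N; [rewrite coprimen1 | exists 1; rewrite mulr1].
- move=> x y /ZlocP[d cod [m xd]] /ZlocP[e coe [n ye]]; apply/ZlocP.
  exists (d * e)%N; first by rewrite coprimeMr cod.
  exists (m * e%:Z - n * d%:Z); rewrite natrM mulrBl mulrA xd mulrCA ye.
  by rewrite rmorphB !rmorphM /=; ring.
- move=> x y /ZlocP[d cod [m xd]] /ZlocP[e coe [n ye]]; apply/ZlocP.
  exists (d * e)%N; first by rewrite coprimeMr cod.
  by exists (m * n); rewrite natrM mulrACA xd ye rmorphM.
Qed.

HB.instance Definition _ :=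
  GRing.isSubringClosed.Build rat (Zloc p) Zloc_subring_closed.

Definition zideal m : pred rat := [pred x | x / (p ^ m)%:R \in Zloc p].

Lemma congZE m x y : congZ p m x y = (x - y \in zideal m).
Proof. by []. Qed.

(** The pattern of most congruences below: give an explicit combination of known members of the
    ideal, and let [ring] identify it with the goal. *)
Lemma eq_zideal m x y : x \in zideal m -> y = x -> y \in zideal m.
Proof. by move=> xI ->. Qed.

Fact zideal_zmod_closed m : zmod_closed (zideal m).
Proof.
split=> [|x y xI yI]; rewrite inE ?mul0r ?rpred0 //.
by rewrite mulrBl rpredB.
Qed.

HB.instance Definition _ m :=
  GRing.isZmodClosed.Build rat (zideal m) (zideal_zmod_closed m).

Lemma p_neq0 : P != 0. Proof. by rewrite pnatr_eq0 -lt0n prime_gt0. Qed.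

Lemma zidealP m x : reflect (exists2 z, z \in Zloc p & x = P ^+ m * z)
  (x \in zideal m).
Proof.
have pm0 : P ^+ m != 0 by rewrite expf_neq0 ?p_neq0.
apply: (iffP idP) => [|[z zZ ->]]; rewrite inE natrX.
  by move=> xZ; exists (x / P ^+ m); rewrite // mulrCA divff ?mulr1.
by rewrite mulrAC divff // mul1r.
Qed.

Lemma zidealMl m x y : x \in Zloc p -> y \in zideal m -> x * y \in zideal m.
Proof.
move=> xZ /zidealP[z zZ ->]; apply/zidealP; exists (x * z); last by ring.
exact: rpredM.
Qed.

Lemma zidealMr m x y : x \in zideal m -> y \in Zloc p -> x * y \in zideal m.
Proof. by move=> xI yZ; rewrite mulrC zidealMl. Qed.

Lemma zidealM m n x y :
  x \in zideal m -> y \in zideal n -> x * y \in zideal (m + n).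
Proof.
move=> /zidealP[u uZ ->] /zidealP[v vZ ->]; apply/zidealP.
by exists (u * v); rewrite ?rpredM // exprD; ring.
Qed.

Lemma zidealX m z : z \in Zloc p -> P ^+ m * z \in zideal m.
Proof. by move=> zZ; apply/zidealP; exists z. Qed.

Lemma zideal1 z : z \in Zloc p -> P * z \in zideal 1.
Proof. by move=> zZ; rewrite -[P]expr1 zidealX. Qed.

Lemma zidealS m x : x \in zideal m -> P * x \in zideal m.+1.
Proof. by move=> /zidealP[z zZ ->]; rewrite mulrA -exprS zidealX. Qed.

Lemma zidealW m x : x \in zideal m -> x \in Zloc p.
Proof. by move=> /zidealP[z zZ ->]; rewrite rpredM ?rpredX ?rpred_nat. Qed.

Lemma zideal21 x : x \in zideal 2 -> x \in zideal 1.
Proof.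
by move=> /zidealP[z zZ ->]; rewrite -mulrA zideal1 // rpredM ?rpred_nat.
Qed.

Lemma zideal_nat k : (k%:R \in zideal 1) = (p %| k)%N.
Proof.
apply/idP/dvdnP => [/zidealP[z /ZlocP[d co_pd [m zd]] kE] | [q ->]]; last first.
  by rewrite natrM mulrC zideal1 ?rpred_nat.
apply/dvdnP; rewrite -(Gauss_dvdl _ co_pd).
suff: (k * d)%N%:Z = p%:Z * m.
  by move/(congr1 absz) => /= ->; rewrite abszM dvdn_mulr.
by apply/eqP; rewrite -(@eqr_int rat) intrM -zd -!pmulrn natrM kE expr1 -mulrA.
Qed.

Lemma Zloc_natV k : coprime p k -> k%:R^-1 \in Zloc p.
Proof.
move=> co_pk; apply/ZlocP; exists k => //; exists 1; rewrite mulVf // pnatr_eq0.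
by apply: contraTneq co_pk => ->; rewrite /coprime gcdn0 gtn_eqF.
Qed.

Lemma Zloc_inv x : x \in Zloc p -> x \notin zideal 1 -> x^-1 \in Zloc p.
Proof.
case/ZlocP=> d co_pd [m xd] xN.
have d0 : d%:R != 0 :> rat.
  rewrite pnatr_eq0; apply: contraTneq co_pd => ->.
  by rewrite /coprime gcdn0 gtn_eqF.
have xE : x = m%:~R / d%:R by rewrite -xd mulfK.
have mE : m%:~R = (-1) ^+ (m < 0)%R * `|m|%N%:R :> rat.
  by rewrite {1}[m]intEsign rmorphM rmorph_sign.
rewrite xE mE invf_div invfM invr_sign !rpredM ?rpred_sign ?rpred_nat //.
apply: Zloc_natV.
rewrite prime_coprime // -zideal_nat; apply: contra xN => mI.
by rewrite xE mE -mulrA zidealMl ?rpred_sign // zidealMr ?Zloc_natV.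
Qed.

(** Elements outside p Z_p are units, so a congruence may first be multiplied by such a factor to
    clear denominators. *)
Lemma zideal_cancel m w x :
  w \in Zloc p -> w \notin zideal 1 -> w * x \in zideal m -> x \in zideal m.
Proof.
move=> wZ wN /(zidealMl (Zloc_inv wZ wN)); rewrite mulKf //.
by apply: contraNneq wN => ->; rewrite rpred0.
Qed.

Lemma nat_notin_zideal k : (0 < k < p)%N -> k%:R \notin zideal 1.
Proof. by move=> /andP[k0 kp]; rewrite zideal_nat gtnNdvd. Qed.

Lemma shift_notin_zideal k u :
  (0 < k < p)%N -> u \in Zloc p -> k%:R + P * u \notin zideal 1.
Proof.
move=> /nat_notin_zideal kN uZ; apply: contra kN => kI.
by rewrite -[k%:R](addrK (P * u)) rpredB ?zideal1.
Qed.

Lemma Zloc_natV_lt k : (0 < k < p)%N -> k%:R^-1 \in Zloc p.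
Proof. by move/nat_notin_zideal/(Zloc_inv (rpred_nat _ _)). Qed.

Lemma Zloc_binq x k : x \in Zloc p -> (k < p)%N -> binq x k \in Zloc p.
Proof.
move=> xZ; elim: k => [|k IHk] kp; first by rewrite binq0 rpred1.
have kp' := ltnW kp.
by rewrite binqS rpredM ?Zloc_natV_lt // rpredM ?IHk // rpredB ?rpred_nat.
Qed.

(* [rewrite rpredM] would unfold [binq] and split its product, hence the
   dispatch on the syntax of the goal. *)
Ltac zloc := first [assumption | lazymatch goal with
  | |- is_true (_ * _ \in _) => apply: rpredM; zloc
  | |- is_true (_ + _ \in _) => apply: rpredD; zloc
  | |- is_true (- _ \in _) => rewrite rpredN; zloc
  | |- is_true (_ ^+ _ \in _) => apply: rpredX; zloc
  | |- is_true (_%:R \in _) => exact: rpred_nat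
  | |- is_true (1 \in _) => exact: rpred1
  | |- is_true (0 \in _) => exact: rpred0
  | |- is_true (binq _ _ \in _) => apply: Zloc_binq; zloc
  | |- _ => idtac
  end].

(** In a product the right factor must be the member of the ideal; hence the shape of the
    combinations below, with factors such as [P ^+ 2 * 1] matched by hypotheses. *)
Ltac zideal := first [assumption | lazymatch goal with
  | |- is_true (_ + _ \in _) => apply: rpredD; zideal
  | |- is_true (- _ \in _) => rewrite rpredN; zideal
  | |- is_true (_ * _ \in _) => apply: zidealMl; [zloc | zideal]
  | |- is_true (0 \in _) => exact: rpred0
  | |- _ => idtac
  end].

(** * Powers and binomial coefficients modulo p and p^2 *)

Lemma zidealBX x y k : x \in Zloc p -> y \in Zloc p -> x - y \in zideal 1 ->
  x ^+ k - y ^+ k \in zideal 1.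
Proof.
move=> xZ yZ xy; rewrite subrXX zidealMr // rpred_sum // => i _.
by rewrite rpredM ?rpredX.
Qed.

Lemma fermat_Zloc k u : (0 < k < p)%N -> u \in Zloc p ->
  (k%:R + P * u) ^+ p.-1 - 1 \in zideal 1.
Proof.
move=> kp uZ; rewrite -[_ - 1](subrKA (k%:R ^+ p.-1)) rpredD //.
  by apply: zidealBX; [zloc | zloc | rewrite addrAC subrr add0r zideal1].
have /eqP := fermat_little k p_pr; have [k0 _] := andP kp.
have le : (k <= k ^ p)%N.
  by rewrite -{1}[k]expn1; exact: (leq_pexp2l k0 (prime_gt0 p_pr)).
rewrite eqn_mod_dvd // -zideal_nat natrB // natrX => kpI.
apply: (@zideal_cancel _ k%:R); rewrite ?rpred_nat ?nat_notin_zideal //.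
by rewrite mulrBr mulr1 -exprS prednK ?prime_gt0.
Qed.

(* [h] does not depend on [u], so evaluating at [u = - 1], where the binomial is
   'C(p - 1, k), determines it; at [k = p - 1] this replaces the vanishing of
   the harmonic number H_(p-1) modulo p. *)
Lemma binq_multpB1 k : (k < p)%N -> exists2 h, h \in Zloc p &
  forall u, u \in Zloc p ->
    binq (- 1 - P * u) k - (- 1) ^+ k * (1 + P * u * h) \in zideal 2.
Proof.
elim: k => [_|k IHk ltkp].
  exists 0; first exact: rpred0.
  by move=> u _; rewrite binq0 expr0 mulr0 addr0 mulr1 subrr rpred0.
have [h hZ hP] := IHk (ltnW ltkp); pose w : rat := k.+1%:R^-1.
have wZ : w \in Zloc p by apply: Zloc_natV_lt.
exists (h + w) => [|u uZ]; first zloc.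
have -> : binq (- 1 - P * u) k.+1 = - (1 + P * u * w) * binq (- 1 - P * u) k.
  by rewrite binqS /w -natr1; field; rewrite natr1 pnatr_eq0.
rewrite exprS; set s := (-1) ^+ k; set B := binq _ _.
have -> : - (1 + P * u * w) * B - -1 * s * (1 + P * u * (h + w))
  = - (1 + P * u * w) * (B - s * (1 + P * u * h))
    + - (s * u ^+ 2 * w * h) * (P ^+ 2 * 1) by ring.
have IH := hP u uZ; apply: rpredD; apply: zidealMl; first by zloc.
- exact: IH.
- by rewrite /s; zloc.
- exact: (zidealX 2 (rpred1 _)).
Qed.

Lemma binq_multpB1_mod1 u k : u \in Zloc p -> (k < p)%N ->
  binq (P * u - 1) k - (- 1) ^+ k \in zideal 1.
Proof.
move=> uZ kp; have [h hZ /(_ (- u))] := binq_multpB1 kp.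
rewrite rpredN => /(_ uZ)/zideal21; rewrite mulrN opprK [-1 + _]addrC => e.
rewrite -[_ - _](addrK (P * ((- 1) ^+ k * (u * h)))).
apply: rpredB; last by apply: zideal1; zloc.
by apply: (eq_zideal e); ring.
Qed.

Hypothesis p_odd : odd p.

Lemma binq_multpB1_max u : u \in Zloc p ->
  binq (- 1 - P * u) p.-1 - 1 \in zideal 2.
Proof.
move=> uZ; have lt_p : (p.-1 < p)%N by rewrite prednK ?prime_gt0.
have [h hZ hP] := binq_multpB1 lt_p.
have s1 : (- 1) ^+ p.-1 = 1 :> rat.
  by rewrite -signr_odd -subn1 oddB ?prime_gt0 // p_odd.
(* At u = -1 the binomial is C(p-1, p-1) = 1, which forces this. *)
have Ph : P * h \in zideal 2.
  have := hP (- 1); rewrite rpredN rpred1 mulrN1 opprK => /(_ isT).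
  rewrite (addrC (- 1)) -predn_natr ?prime_gt0 // binq_nat binn s1 mul1r.
  by rewrite mulNr opprD opprK addrA subrr add0r.
have -> : binq (- 1 - P * u) p.-1 - 1
   = binq (- 1 - P * u) p.-1 - (- 1) ^+ p.-1 * (1 + P * u * h) + u * (P * h).
  by rewrite s1; ring.
by apply: rpredD; [exact: hP | exact: zidealMl].
Qed.

(** Absorption takes out the factor pu/k, so the remaining C(pu-1, k-1) is needed only modulo p. *)
Lemma binq_multp u k : u \in Zloc p -> (0 < k < p)%N ->
  binq (P * u) k + (- 1) ^+ k * (P * u / k%:R) \in zideal 2.
Proof.
case: k => // k uZ kp; have kZ := Zloc_natV_lt kp.
have /(binq_multpB1_mod1 uZ) e : (k < p)%N by apply: ltnW.
rewrite binq_absorb exprS.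
rewrite (_ : _ + _ = (u / k.+1%:R) * (P * (binq (P * u - 1) k - (- 1) ^+ k))).
  by apply: zidealMl; [zloc | exact: zidealS].
by ring.
Qed.

(** By [binq_multp] the dependence on u is linear, and the slope is read off at u = 1. *)
Lemma binq_multp_lin u k : u \in Zloc p -> (0 < k < p)%N ->
  binq (P * u) k - u * 'C(p, k)%:R \in zideal 2.
Proof.
move=> uZ kp; have e := binq_multp uZ kp; have := binq_multp (rpred1 _) kp.
rewrite mulr1 binq_nat => e1.
rewrite (_ : _ - _ = binq (P * u) k + (- 1) ^+ k * (P * u / k%:R)
  - u * ('C(p, k)%:R + (- 1) ^+ k * (P / k%:R))); last by ring.
by apply: rpredB => //; apply: zidealMl.
Qed.

(** * The sum T modulo p^2 *)

Notation Q := (2 ^+ p - 2 : rat).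

Lemma pow2_sum_step x :
  pow2_sum p (x + 1) = 2 ^+ p * binq x p.-1 - pow2_sum p x.
Proof.
have := pow2_sum_recr p.-1 x; rewrite prednK ?prime_gt0 // => e.
apply/(canRL (addrK _)); rewrite e exprNn -signr_odd p_odd; ring.
Qed.

Lemma pow2_sum_p : pow2_sum p P = 2 ^+ p - 1.
Proof.
have : (1 - 2) ^+ p = pow2_sum p P + (- 2) ^+ p.
  rewrite exprDn big_ord_recr /= binn subnn expr0 mul1r mulr1n.
  rewrite /pow2_sum big_mkord.
  congr (_ + _); apply: eq_bigr => i _.
  by rewrite binq_nat expr1n mul1r mulr_natl.
have -> : 1 - 2 = - 1 :> rat by [].
by rewrite exprNn [in RHS]exprNn -signr_odd p_odd !expr1n => e; lra.
Qed.

(** Each term with k > 0 is linear in u, and u = 1 is [pow2_sum_p]. *)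
Lemma pow2_sum_multp u : u \in Zloc p ->
  pow2_sum p (P * u) - (1 + u * Q) \in zideal 2.
Proof.
move=> uZ; have -> : Q = pow2_sum p P - 1 by rewrite pow2_sum_p; ring.
have splitT x : pow2_sum p x = 1 + \sum_(1 <= k < p) binq x k * (- 2) ^+ k.
  by rewrite /pow2_sum big_ltn ?prime_gt0 // binq0 mul1r.
rewrite !splitT [1 + _ - 1]addrC addKr.
rewrite (addrC 1) addrKA mulr_sumr -sumrB big_nat rpred_sum // => k kp.
rewrite binq_nat mulrA -mulrBl; apply: zidealMr; last by zloc.
exact: binq_multp_lin.
Qed.

Lemma fermat2 : Q \in zideal 1.
Proof.
rewrite -natrX -natrB; last by rewrite -{1}[2%N]expn1 leq_pexp2l ?prime_gt0.
rewrite zideal_nat -eqn_mod_dvd ?fermat_little //.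
by rewrite -{1}[2%N]expn1 leq_pexp2l ?prime_gt0.
Qed.

(** Two steps of the recurrence lead from -pu back to -2 - pu; this starts both reflection arguments
    below. *)
Lemma pow2_sum_multpB2 u : u \in Zloc p ->
  pow2_sum p (- 2 - P * u) + 1 + (u + 1) * Q - 2 * P * (u + 1) \in zideal 2.
Proof.
move=> uZ; have eB := binq_multpB1_max uZ.
have uNZ : - u \in Zloc p by zloc.
have eT := pow2_sum_multp uNZ; rewrite mulrN (mulNr u) in eT.
have := pow2_sum_step (- 1 - P * u); have := pow2_sum_step (- 2 - P * u).
set B1 := binq (- 1 - P * u) _ in eB *.
have bE : (1 + P * u) * binq (- 2 - P * u) p.-1 = (P * (u + 1)) * B1.
  have := binq_pred_mul (- 1 - P * u) p.-1.
  rewrite predn_natr ?prime_gt0 // -/B1.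
  have -> : - 1 - P * u - 1 = - 2 - P * u by ring.
  by move=> e; rewrite -[LHS]opprK -mulNr opprD e; ring.
set B2 := binq _ _ in bE *; set T2 := pow2_sum p (- 2 - _).
have -> : - 2 - P * u + 1 = - 1 - P * u by ring.
have -> : - 1 - P * u + 1 = - (P * u) by ring.
set T1 := pow2_sum p (- 1 - _); set T0 := pow2_sum p _ in eT *.
move=> e1 e2; have -> : T2 = 2 ^+ p * B2 - 2 ^+ p * B1 + T0.
  by rewrite e2 e1; ring.
(* Multiplying by the unit 1 + pu lets [bE] eliminate [B2] exactly. *)
have wN := shift_notin_zideal (k := 1) p_gt1 uZ.
apply: (zideal_cancel _ wN); first by zloc.
have QP := zidealM fermat2 (zideal1 (rpred1 _)).
set Q := 2 ^+ p - 2 in eT QP *; have -> : 2 ^+ p = Q + 2 by rewrite /Q; ring.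
rewrite (_ : _ * _ = (1 + P * u) * (T0 - (1 - u * Q))
   + (Q + 2) * (P * (u + 1) - (1 + P * u)) * (B1 - 1)
   + (u + 1) * (Q * (P * 1)) - 2 * u * (u + 1) * (P ^+ 2 * 1)); last first.
  rewrite !(mulrDr (1 + P * u)) !mulrN.
  have -> : (1 + P * u) * ((Q + 2) * B2) = (Q + 2) * ((P * (u + 1)) * B1).
    by rewrite -bE; ring.
  by ring.
have QZ := zidealW fermat2; rewrite -/Q in QZ.
have P2 := zidealX 2 (rpred1 _).
zideal.
Qed.

(* The ratio of the left terms for [s + 1] and [s] is congruent to 1 modulo p,
   so the case [s = 0] propagates without Wilson's theorem; the same holds for
   [binq_shift_half]. *)
Lemma binq_shift s u : (s.+1 < p)%N -> u \in Zloc p ->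
  (s%:R + P * u + 1) * binq (s%:R + P * u) p.-1 - P * u \in zideal 2.
Proof.
move=> + uZ; elim: s => [_|s IHs lt_s_p].
  rewrite add0r.
  have p1P : (0 < p.-1 < p)%N by move: p_gt1; lia.
  have := binq_multp_lin uZ p1P.
  have -> : 'C(p, p.-1) = p 
    by rewrite -subn1 (bin_sub (prime_gt0 p_pr)) bin1.
  move: (binq _ _) => B e; have P2 := zidealX 2 (rpred1 _).
  rewrite (_ : _ - _ = (P * u + 1) * (B - u * P) + u ^+ 2 * (P ^+ 2 * 1)).
    by zideal.
  by ring.
have {IHs} := IHs (ltnW lt_s_p).
have -> : s.+1%:R + P * u = s%:R + P * u + 1 by rewrite -natr1; ring.
have xZ : s%:R + P * u \in Zloc p by zloc.
(* With x = s + pu this is x + 2 - p, the factor that [binq_pred_mul] puts before C(x+1, p-1). *)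
have wN : s.+2%:R + P * (u - 1) \notin zideal 1.
  by apply: shift_notin_zideal => //; zloc.
have P2 := zidealX 2 (rpred1 _).
move: wN; rewrite -natr1 -natr1; set x := s%:R + P * u in xZ * => wN e.
apply: (zideal_cancel _ wN); first by zloc.
have := binq_pred_mul (x + 1) p.-1.
rewrite addrK predn_natr ?prime_gt0 // => eB.
move: e; rewrite eB; move: (binq _ _) => B e.
apply: (@eq_zideal _ ((x + 2) * ((x + 1 - (P - 1)) * B - P * u)
  + u * (P ^+ 2 * 1))).
  by zideal.
by rewrite /x; ring.
Qed.

Lemma sum_bin_inner : \sum_(1 <= j < p) 'C(p, j)%:R = Q.
Proof.
have : (1 + 1) ^+ p = \sum_(0 <= j < p.+1) 'C(p, j)%:R :> rat.
  rewrite exprDn big_mkord; apply: eq_bigr => i _.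
  by rewrite !expr1n mulr1.
rewrite big_nat_recr //= big_ltn ?prime_gt0 // bin0 binn.
by rewrite (_ : 1 + 1 = 2) // => ->; ring.
Qed.

(** For x = s + 1 + pu one has -2 - x = r + p(-1-u), so [binq_shift] also applies at -2 - x. *)
Lemma residue_complement s : (s.+2 < p)%N ->
  exists2 r, (r.+1 < p)%N & p = (s + r + 3)%N.
Proof. by move=> lt_s_p; exists (p - 3 - s)%N; lia. Qed.

(** Induction on s: raising x by one lowers -2 - x by one, and both steps of the recurrence have
    their binomials given by [binq_shift]. The unit x clears denominators. *)
Lemma pow2_sum_reflect s u x :
  (s.+1 < p)%N -> u \in Zloc p -> x = s%:R + P * u ->
  (x + 1) * (u * pow2_sum p (- 2 - x) + (u + 1) * pow2_sum p x - (- 1) ^+ s)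
    - 2 * P * u * (u + 1) \in zideal 2.
Proof.
move=> + uZ; have P2 := zidealX 2 (rpred1 _).
have PQ := zidealM fermat2 (zideal1 (rpred1 _)); have QZ := zidealW fermat2.
have eT := pow2_sum_multp uZ; have eT2 := pow2_sum_multpB2 uZ.
move: PQ QZ eT eT2; move qE: (2 ^+ p - 2) => q PQ QZ eT eT2.
have p2E : 2 ^+ p = q + 2 by rewrite -qE; ring.
elim: s x => [|s IHs] x.
  rewrite add0r => _ ->; move: eT eT2.
  move: (pow2_sum p (P * u)) (pow2_sum p (- 2 - P * u)) => T T2 eT eT2.
  apply: (@eq_zideal _ ((P * u + 1) *
    (u * (T2 + 1 + (u + 1) * q - 2 * P * (u + 1))
     + (u + 1) * (T - (1 + u * q))) + 2 * u ^+ 2 * (u + 1) * (P ^+ 2 * 1))).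
    by zideal.
  by ring.
move=> lt_s_p xE; have e0 := IHs _ (ltnW lt_s_p) erefl.
have eC := binq_shift (ltnW lt_s_p) uZ.
have u1Z : - 1 - u \in Zloc p by zloc.
have [r lt_r_p prE] := residue_complement lt_s_p; have := binq_shift lt_r_p u1Z.
have wN : s.+1%:R + P * u \notin zideal 1.
  by apply: shift_notin_zideal => //; apply: ltnW.
have xZ : x \in Zloc p by rewrite xE; zloc.
have x0E : s%:R + P * u = x - 1 by rewrite xE -natr1; ring.
have x2E : r%:R + P * (- 1 - u) = - 2 - x.
  have -> : r%:R = P - s%:R - 3 by rewrite prE !natrD; ring.
  by rewrite xE -natr1; ring.
move: eC e0 wN; rewrite -xE x2E x0E subrK => eC e0 wN eC2.
apply: (zideal_cancel _ wN); first by zloc.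
have := pow2_sum_step (x - 1); have := pow2_sum_step (- 2 - x).
rewrite subrK p2E exprS.
rewrite (_ : - 2 - x + 1 = - 2 - (x - 1)); last by ring.
have sZ : (- 1) ^+ s \in Zloc p by zloc.
move: ((- 1) ^+ s) sZ e0 => s' sZ e0.
move: (pow2_sum p (- 2 - (x - 1))) (pow2_sum p (- 2 - x)) e0 => R0 R1.
move: (pow2_sum p x) (pow2_sum p (x - 1)) => T1 T0 e0 eR eT1.
move: (binq (- 2 - x) _) (binq (x - 1) _) eC2 eC eR eT1 => C3 C eC3 eC eR ->.
have -> : R1 = (q + 2) * C3 - R0 by rewrite eR; ring.
apply: (@eq_zideal _ (- (x + 1) * (x *
     (u * R0 + (u + 1) * T0 - s') - 2 * P * u * (u + 1))
  + (q + 2) * (- (x * u) * ((- 2 - x + 1) * C3 - P * (- 1 - u))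
               + (x + 1) * (u + 1) * (x * C - P * u))
  + u * (u + 1) * (2 * x + 1) * (q * (P * 1)))); last by ring.
by zideal.
Qed.

(** * Euler polynomials modulo p and their link with T *)

Lemma Zloc_euler_number r : euler_number r \in Zloc p.
Proof.
elim/ltn_ind: r => -[|r] IHr; first by rewrite euler_number0 rpred1.
rewrite euler_numberE // rpredN big_nat rpred_sum // => k /andP[k0 _].
by rewrite rpredM ?rpred_nat // IHr // ltn_subrL muln_gt0 k0.
Qed.

Lemma Zloc_exprV2 m : 2 ^- m \in Zloc p.
Proof. by rewrite -exprVn rpredX // Zloc_natV // coprime_sym coprime2n. Qed.

Lemma euler_poly_cong m x y : x \in Zloc p -> y \in Zloc p ->
  x - y \in zideal 1 -> (euler_poly m).[x] - (euler_poly m).[y] \in zideal 1.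
Proof.
move=> xZ yZ xy; rewrite !horner_euler_poly -mulrBr.
apply: zidealMl; first exact: Zloc_exprV2.
rewrite /euler_sum -sumrB rpred_sum // => r _; rewrite -mulrBr.
apply: zidealMl; first by rewrite rpredM ?rpred_nat ?Zloc_euler_number.
apply: zidealBX; [zloc | zloc |].
by apply: (@eq_zideal _ (2 * (x - y))); [zideal | ring].
Qed.

Lemma euler_poly_alt_sum m k :
  (- 1) ^+ k * (euler_poly m).[k%:R]
  = (euler_poly m).[0] - 2 * \sum_(0 <= i < k) (- 1) ^+ i * i%:R ^+ m.
Proof.
elim: k => [|k IHk]; first by rewrite big_geq // mul1r mulr0 subr0.
rewrite big_nat_recr //= mulrDr opprD addrA -IHk exprS -natr1.
have := euler_poly_step m k%:R => /(canRL (addrK _)) ->; ring.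
Qed.

(** The alternating sum up to p gives 2A = E(0) + E(p), so E(0) = A modulo p. By Fermat A is the sum
    of (-1)^j/j, and p(-1)^j/j = -C(p, j) modulo p^2; the inner binomials add up to Q. *)
Lemma euler_poly_0_modp : P * (euler_poly (p - 2)).[0] + Q \in zideal 2.
Proof.
set e0 := (euler_poly _).[0].
pose A : rat := \sum_(0 <= i < p) (- 1) ^+ i * i%:R ^+ (p - 2).
have eA : e0 - A \in zideal 1.
  apply: (@zideal_cancel _ 2).
  - exact: rpred_nat.
  - by apply: nat_notin_zideal; move: p_gt1 p_odd; lia.
  have := euler_poly_alt_sum (p - 2) p.
  rewrite -signr_odd p_odd mulN1r -/A -/e0.
  move=> e; have : (euler_poly (p - 2)).[P] - e0 \in zideal 1.
    apply: euler_poly_cong; rewrite ?rpred_nat ?rpred0 // subr0.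
    by rewrite -[P]mulr1 zideal1 ?rpred1.
  rewrite -rpredN => e'; apply: (eq_zideal e').
  by rewrite opprB -[X in _ = _ + X]opprK; lra.
apply: (@eq_zideal _ (P * (e0 - A) + (P * A + Q))); last by ring.
apply: rpredD; first exact: zidealS.
rewrite -sum_bin_inner /A big_ltn ?prime_gt0 // expr0n.
(* The term i = 0 of A vanishes because p - 2 > 0. *)
have -> : (p - 2 == 0)%N = false by move: p_gt1 p_odd; lia.
rewrite mulr0 add0r mulr_sumr -big_split /= big_nat rpred_sum // => j jp.
have := binq_multp (rpred1 _) jp; rewrite mulr1 binq_nat => eC.
have := fermat_Zloc jp (rpred0 _); rewrite mulr0 addr0 => eF.
have jZ := Zloc_natV_lt jp.
have j0 : j%:R != 0 :> rat by rewrite pnatr_eq0 -lt0n; case/andP: jp.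
have e1 : j%:R ^+ p.-1 = j%:R * j%:R ^+ (p - 2) :> rat.
  by rewrite -exprS; congr (_ ^+ _); move: p_gt1; lia.
rewrite e1 in eF.
apply: (@eq_zideal _ (('C(p, j)%:R + (- 1) ^+ j * (P / j%:R))
  + (- 1) ^+ j * j%:R^-1 * (P * (j%:R * j%:R ^+ (p - 2) - 1)))).
  apply: rpredD => //; apply: zidealMl; first by zloc.
  exact: zidealS.
by field.
Qed.

(** Since p divides u, the terms pu and uQ vanish modulo p^2. The base case joins the values of T at
    -2 - pu and of E_(p-2) at 0; the induction step matches the two recurrences through x x^(p-2) =
    1 modulo p. *)
Lemma pow2_sum_euler s u x :
  (s.+1 < p)%N -> u \in zideal 1 -> x = s%:R + P * u ->
  (x + 1) * (pow2_sum p (- 2 - x) + (- 1) ^+ s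
             - P * (euler_poly (p - 2)).[- x]) - 2 * P \in zideal 2.
Proof.
have p2 : (p - 2).+1 = p.-1 by move: p_gt1; lia.
move=> + uI; have uZ := zidealW uI; have P2 := zidealX 2 (rpred1 _).
have Pu := zidealS uI.
have PQ := zidealM fermat2 (zideal1 (rpred1 _)); have QZ := zidealW fermat2.
have uQ := zidealM uI fermat2.
have eT2 := pow2_sum_multpB2 uZ; have eE := euler_poly_0_modp.
have s_odd : (- 1) ^+ (p - 2) = - 1 :> rat.
  by rewrite -signr_odd oddB ?prime_gt1 // p_odd.
move: PQ QZ uQ eT2 eE; move qE: (2 ^+ p - 2) => q PQ QZ uQ eT2 eE.
have p2E : 2 ^+ p = q + 2 by rewrite -qE; ring.
elim: s x => [|s IHs] x.
  rewrite add0r => _ ->.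
  have : P * ((euler_poly (p - 2)).[- (P * u)] - (euler_poly (p - 2)).[0])
      \in zideal 2.
    apply/zidealS/euler_poly_cong; [zloc | exact: rpred0 |].
    by rewrite subr0 rpredN zideal1.
  move: eT2 eE; rewrite expr0.
  move: (pow2_sum _ _) ((euler_poly _).[0]) ((euler_poly _).[- (P * u)]).
  move=> T E0 E1 eT eE e01.
  apply: (@eq_zideal _ ((P * u + 1) * (T + 1 + (u + 1) * q - 2 * P * (u + 1)
      - P * (E1 - E0) - (P * E0 + q) - u * q)
    + (2 * (P * u + 1) + 2 * P) * (P * u))).
    by zideal.
  by ring.
move=> lt_s_p xE; have e0 := IHs _ (ltnW lt_s_p) erefl.
have [r lt_r_p prE] := residue_complement lt_s_p.
have u1Z : - 1 - u \in Zloc p by zloc.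
have := binq_shift lt_r_p u1Z.
have s1p : (0 < s.+1 < p)%N by apply: ltnW.
have wN := shift_notin_zideal s1p uZ.
have eF := fermat_Zloc s1p uZ.
have xZ : x \in Zloc p by rewrite xE; zloc.
have x0E : s%:R + P * u = x - 1 by rewrite xE -natr1; ring.
have x2E : r%:R + P * (- 1 - u) = - 2 - x.
  have -> : r%:R = P - s%:R - 3 by rewrite prE !natrD; ring.
  by rewrite xE -natr1; ring.
move: eF e0 wN; rewrite -xE x2E x0E subrK => eF e0 wN eC3.
apply: (zideal_cancel _ wN); first by zloc.
have := pow2_sum_step (- 2 - x); have := euler_poly_step (p - 2) (- x).
rewrite p2E exprS (exprNn x) s_odd.
rewrite (_ : - 2 - x + 1 = - 2 - (x - 1)); last by ring.
rewrite (_ : - x + 1 = - (x - 1)); last by ring.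
have sZ : (- 1) ^+ s \in Zloc p by zloc.
rewrite -p2 exprS in eF; move: eF.
have yZ : x ^+ (p - 2) \in Zloc p by zloc.
move: (x ^+ (p - 2)) ((- 1) ^+ s) yZ sZ e0 => y s' yZ sZ e0 eF.
move: (pow2_sum p (- 2 - (x - 1))) (pow2_sum p (- 2 - x)) e0 => R0 R1.
move: (euler_poly _).[- (x - 1)] (euler_poly _).[- x] => E0 E1 e0 eE1.
move: (binq (- 2 - x) _) eC3 => C3 eC3 eR.
have -> : R1 = (q + 2) * C3 - R0 by rewrite eR; ring.
have -> : E1 = 2 * (-1 * y) - E0 by rewrite -eE1; ring.
have eF' := zidealS eF.
apply: (@eq_zideal _ (- (x + 1) * (x * (R0 + s' - P * E0) - 2 * P)
  - (q + 2) * x * ((- 2 - x + 1) * C3 - P * (- 1 - u))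
  + x * (u + 1) * (q * (P * 1)) + 2 * x * (P * u)
  + 2 * (x + 1) * (P * (x * y - 1)))); last by ring.
by zideal.
Qed.

(** * The sum f for residues up to n = (p-1)/2 *)

Section HalfRange.

Variables (n : nat) (pE : p = n.*2.+1).

Let PE : P = 2 * n%:R + 1.
Proof. by rewrite pE -natr1 -mul2n natrM. Qed.

Lemma binq_shift_half i t a :
  (i <= n)%N -> t \in Zloc p -> a = i%:R + P * t ->
  a * (binq (a - 1) n * binq (- 1 - a) n) - P * t \in zideal 2.
Proof.
move=> + tZ; have np : (n < p)%N by rewrite pE; lia.
elim: i a => [|i IHi] a.
  rewrite add0r => _ ->.
  (* For i = 0 both binomials are (-1)^n modulo p, so their product is 1. *)
  have e1 := binq_multpB1_mod1 tZ np.
  have e2 : binq (- 1 - P * t) n - (- 1) ^+ n \in zideal 1.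
    have -> : - 1 - P * t = P * (- t) - 1 by ring.
    by apply: binq_multpB1_mod1; zloc.
  have BZ : binq (- 1 - P * t) n \in Zloc p by zloc.
  move: (binq (P * t - 1) n) (binq (- 1 - P * t) n) e1 e2 BZ => B1 B2 e1 e2 BZ.
  have s2 : (- 1) ^+ n * (- 1) ^+ n = 1 :> rat by rewrite -exprMn mulrNN expr1n.
  have sZ : (- 1) ^+ n \in Zloc p by zloc.
  move: s2 sZ e1 e2; set s := (- 1) ^+ n => s2 sZ e1 e2.
  apply: (@eq_zideal _ (t * (P * (B2 * (B1 - s) + s * (B2 - s))))).
    by apply: zidealMl => //; apply: zidealS; zideal.
  rewrite [RHS](_ : _ = P * t * (B1 * B2) - P * t * (s * s)); last by ring.
  by rewrite s2 mulr1.
move=> lt_i_n aE; have {IHi} := IHi _ (ltnW lt_i_n) erefl.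
have xZ : i%:R + P * t \in Zloc p by zloc.
have wN : (n - i)%:R + P * (- t) \notin zideal 1.
  by apply: shift_notin_zideal; [rewrite pE; lia | zloc].
have P2 := zidealX 2 (rpred1 _).
have {aE} -> : a = i%:R + P * t + 1 by rewrite aE -natr1; ring.
move: wN; rewrite natrB ?(ltnW lt_i_n) //; clear a.
(* From here on [a] is the previous argument. The ratio of consecutive values is -(a+n+1)/(n-a),
   which is 1 modulo p because (a+n+1) + (n-a) = p. *)
set a := i%:R + P * t in xZ * => wN e.
apply: (zideal_cancel _ wN); first by zloc.
have := binq_pred_mul a n; have := binq_pred_mul (- 1 - a) n.
rewrite addrK (_ : - 1 - (a + 1) = - 1 - a - 1); last by ring.
move: e; move: (binq (a - 1) n) (binq a n) (binq (- 1 - a) n) => A1 A0 B0.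
move: (binq (- 1 - a - 1) n) => B1 e eB eA.
apply: (@eq_zideal _ (- (a + n%:R + 1) * (a * (A1 * B0) - P * t)
   - t * (P ^+ 2 * 1))); first by zideal.
have eB' : (a + 1) * B1 = (a + n%:R + 1) * B0 by lra.
have eA' : (n%:R - a) * A0 = - (a * A1) by lra.
have -> : n%:R - i%:R + P * - t = n%:R - a by rewrite /a; ring.
transitivity ((n%:R - a) * A0 * ((a + 1) * B1) - (n%:R - a) * (P * t)).
  by ring.
by rewrite eA' eB' PE; ring.
Qed.

(** The term k = 0 is -1. For k > 0 the term is -pt/(k(2k-1)) = -2t(p/(2k-1) - p/(2k)) modulo p^2,
    that is -2t(C(p, 2k-1) + C(p, 2k)); these pairs exhaust the inner binomials, with sum Q. *)
Lemma legendre_sum_multp t : t \in Zloc p ->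
  legendre_sum n (P * t) + 1 + 2 * t * Q \in zideal 2.
Proof.
move=> tZ; rewrite -sum_bin_inner [in X in \sum_(_ <= _ < X) _]pE.
rewrite -(sum_pairs (fun j => 'C(p, j)%:R)) /legendre_sum big_ltn //.
rewrite !binq0 mulr0 sub0r mulr1 invrN1 mul1r.
rewrite (addrC (- 1)) addrNK mulr_sumr -big_split /= big_nat.
apply: rpred_sum => k /andP[k0 kn].
have k1P : (0 < k < p)%N by rewrite pE; lia.
have k2P : (0 < 2 * k < p)%N by rewrite pE; lia.
have k3P : (0 < 2 * k - 1 < p)%N by rewrite pE; lia.
have k3E : (2 * k - 1)%:R = 2 * k%:R - 1 :> rat.
  by rewrite natrB ?natrM // muln_gt0.
have k0' : k%:R != 0 :> rat by rewrite pnatr_eq0 -lt0n.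
have eX := binq_multp tZ k1P.
have eY : binq (- 1 - P * t) k - (- 1) ^+ k \in zideal 1.
  have -> : - 1 - P * t = P * (- t) - 1 by ring.
  by apply: binq_multpB1_mod1; [zloc | case/andP: k1P].
have YZ : binq (- 1 - P * t) k \in Zloc p by case/andP: k1P => _ ?; zloc.
have := binq_multp (rpred1 _) k2P; have := binq_multp (rpred1 _) k3P.
have -> : (- 1) ^+ (2 * k) = 1 :> rat by rewrite exprM sqrrN !expr1n.
have -> : (- 1) ^+ (2 * k - 1) = -1 :> rat.
  by rewrite -signr_odd oddB ?muln_gt0 // oddM.
rewrite !mulr1 !binq_nat k3E natrM mul1r mulN1r.
have kZ := Zloc_natV_lt k1P; have := Zloc_natV_lt k3P; rewrite k3E.
have s2 : (- 1) ^+ k * (- 1) ^+ k = 1 :> rat.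
  by rewrite -exprMn mulrNN !expr1n.
have sZ : (- 1) ^+ k \in Zloc p by zloc.
have := odd_neq0 k.
move: s2 sZ eX eY YZ.
move: ((- 1) ^+ k) (binq (P * t) k) (binq (- 1 - P * t) k) => s X Y.
move=> s2 sZ eX eY YZ c0 cZ e3 e2.
apply: (@eq_zideal _ ((2 * k%:R - 1)^-1 * (Y * (X + s * (P * t / k%:R))
   - (s * t / k%:R) * (P * (Y - s)))
  + 2 * t * (('C(p, 2 * k - 1)%:R - P / (2 * k%:R - 1))
             + ('C(p, 2 * k)%:R + P / (2 * k%:R))))).
  apply: rpredD; apply: zidealMl; [zloc | | zloc |by zideal].
  apply: rpredB; first by zideal.
  by apply: zidealMl; [zloc | exact: zidealS].
move: ('C(p, 2 * k)%:R) ('C(p, 2 * k - 1)%:R) => C1 C2.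
(* Adding a multiple of s^2 - 1 = 0 makes the identity one of rational functions, within reach of
   [field]. *)
have -> : X * Y / (2 * k%:R - 1)
    = (X * Y + P * t / k%:R * (s * s - 1)) / (2 * k%:R - 1).
  by rewrite s2 subrr mulr0 addr0.
by field; rewrite k0' c0.
Qed.

(** Raising a by one raises 2a by two, so one step for f is set against two for T. The factors 2a
    and 2a - 1 cleared in the induction step are units, their residues being positive and below
    p. *)
Lemma legendre_sum_lower i t a :
  (i <= n)%N -> t \in Zloc p -> a = i%:R + P * t ->
  legendre_sum n a - 2 * P * t + (2 * a + 1) * pow2_sum p (2 * a) \in zideal 2.
Proof.
have lt_double i' : (i' < n)%N -> ((2 * i').+2 < p)%N by rewrite pE; lia.
move=> + tZ; have P2 := zidealX 2 (rpred1 _).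
have PQ := zidealM fermat2 (zideal1 (rpred1 _)); have QZ := zidealW fermat2.
move: PQ QZ; move qE: (2 ^+ p - 2) => q PQ QZ.
have p2E : 2 ^+ p = q + 2 by rewrite -qE; ring.
have t2Z : 2 * t \in Zloc p by zloc.
elim: i a => [|i IHi] a.
  rewrite add0r => _ ->; have := legendre_sum_multp tZ.
  have := pow2_sum_multp t2Z; rewrite qE.
  have -> : P * (2 * t) = 2 * (P * t) by ring.
  move: (legendre_sum _ _) (pow2_sum _ _) => f T eT ef.
  apply: (@eq_zideal _ ((f + 1 + 2 * t * q) + (2 * (P * t) + 1) *
    (T - (1 + 2 * t * q)) + (4 * t ^+ 2) * (q * (P * 1)))); last by ring.
  by zideal.
move=> lt_i_n aE; have e0 := IHi _ (ltnW lt_i_n) erefl.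
have eb := binq_shift_half lt_i_n tZ aE.
have lt1 := lt_double i lt_i_n.
have eC1 := binq_shift lt1 t2Z; have eC2 := binq_shift (ltnW lt1) t2Z.
have w1N : (2 * i).+2%:R + P * (2 * t) \notin zideal 1.
  by apply: shift_notin_zideal.
have w2N : (2 * i).+1%:R + P * (2 * t) \notin zideal 1.
  by apply: shift_notin_zideal => //; apply: ltnW.
have aZ : a \in Zloc p by rewrite aE; zloc.
have x0E : i%:R + P * t = a - 1 by rewrite aE -natr1; ring.
have x1E : (2 * i)%:R + P * (2 * t) = 2 * a - 2.
  by rewrite aE natrM -natr1; ring.
have x2E : (2 * i).+1%:R + P * (2 * t) = 2 * a - 1.
  by rewrite aE -natr1 natrM -natr1; ring.
have x3E : (2 * i).+2%:R + P * (2 * t) = 2 * a.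
  by rewrite aE -!natr1 natrM; ring.
move: e0 w1N w2N eC1 eC2; rewrite x0E x1E x2E x3E.
rewrite (_ : 2 * a - 1 + 1 = 2 * a); last by ring.
rewrite (_ : 2 * a - 2 + 1 = 2 * a - 1); last by ring.
rewrite (_ : 2 * (a - 1) = 2 * a - 2); last by ring.
move=> e0 w1N w2N eC1 eC2.
apply: (zideal_cancel _ w1N); first by zloc.
apply: (zideal_cancel _ w2N); first by zloc.
have := pow2_sum_step (2 * a - 1); have := pow2_sum_step (2 * a - 2).
rewrite (_ : 2 * a - 2 + 1 = 2 * a - 1); last by ring.
rewrite (_ : 2 * a - 1 + 1 = 2 * a); last by ring.
rewrite p2E => -> ->; have := legendre_sum_recr n a.
move: (legendre_sum n a) (legendre_sum n (a - 1)) (pow2_sum _ _) e0.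
move=> f f' T e0.
move: (binq (2 * a - 2) _) (binq (2 * a - 1) _) eC1 eC2 => C2 C1 eC1 eC2.
rewrite -mulrA; move: (_ * binq (- 1 - a) n) eb => b eb ef.
apply: (@eq_zideal _ (
  2 * a * (2 * a + 1) * (f' - 2 * P * t + (2 * a - 2 + 1) * T)
  + 4 * (a * b - P * t)
  + (2 * a + 1) * (q + 2) * ((2 * a - 1) * (2 * a * C1 - P * (2 * t))
     - 2 * a * ((2 * a - 1) * C2 - P * (2 * t)))
  - 2 * (2 * a + 1) * t * (q * (P * 1)))).
  by zideal.
transitivity (2 * a * ((2 * a - 1) * f) - 2 * a * (2 * a - 1) * (2 * P * t)
  + 2 * a * (2 * a - 1) * (2 * a + 1) * ((q + 2) * C1 - ((q + 2) * C2 - T))).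
  by ring.
have -> : (2 * a - 1) * f = 2 * b + (2 * a + 1) * f' by rewrite -ef; ring.
by ring.
Qed.

End HalfRange.

End PIntegral.

Theorem theorem4p4 (p : nat) (a : rat) :
  prime p -> (3 < p)%N -> a \in Zloc p -> ~~ congZ p 1 a 0 ->
  let r : rat := (lres p a)%:R in
  let t : rat := (a - r) / p%:R in
  let L : rat :=
    \sum_(0 <= k < ((p - 1) %/ 2).+1)
      binq a k * binq (- 1 - a) k / (2 * k%:R - 1) in
  let S : rat := \sum_(0 <= k < p) binq (2 * a) k * (- 2) ^+ k in
  [/\ r < p%:R / 2 ->
        congZ p 2 L (2 * p%:R * t - (2 * a + 1) * S),
      p%:R / 2 < r -> ~~ congZ p 1 t (- (1 / 2)) ->
        congZ p 2 L
          (2 * p%:R * (t + 1) - (2 * a + 1) / (2 * t + 1)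
             - (2 * a + 1) * (1 + 1 / (2 * t + 1)) * S)
    & p%:R / 2 < r -> congZ p 1 t (- (1 / 2)) ->
        congZ p 2 L
          (2 * a + 1
             + p%:R * (1 + (2 * a + 1)
                             * (euler_poly (p - 2)).[- (2 * a)]))].
Proof.
move=> p_pr p_gt3 aZ _; have [lt_m_p mE] := lresP p_pr aZ.
set m := lres p a in lt_m_p mE *; move=> r t L S.
have tZ : t \in Zloc p by move: mE; rewrite /congZ expn1.
have p_odd : odd p by case/even_prime: p_pr p_gt3 => [->|].
have pE : p = p./2.*2.+1 by rewrite -[LHS]odd_double_half p_odd.
have P0 := p_neq0 p_pr.
have aE : a = m%:R + p%:R * t by rewrite /t mulrC divfK // addrC subrK.
have LE : L = legendre_sum p./2 a.
  by rewrite /L (_ : (p - 1) %/ 2 = p./2)%N // {1}pE subn1 divn2 doubleK.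
have SE : S = pow2_sum p (2 * a) by [].
rewrite !congZE {}LE {}SE /r; clearbody t; clear mE r.
have half (k : nat) : p%:R / 2 < k%:R :> rat -> (p < 2 * k)%N.
  by rewrite ltr_pdivrMr // mulrC -natrM ltr_nat.
have half' (k : nat) : k%:R < p%:R / 2 :> rat -> (2 * k < p)%N.
  by rewrite ltr_pdivlMr // mulrC -natrM ltr_nat.
have uZ : 2 * t + 1 \in Zloc p by rewrite rpredD ?rpredM ?rpred_nat ?rpred1.
(* The complement -1 - a has residue p - 1 - m, at most (p-1)/2, and quotient -1 - t, while f is
   unchanged. *)
have reflected : (p < 2 * m)%N -> legendre_sum p./2 a + 2 * p%:R * (t + 1)
    - (2 * a + 1) * pow2_sum p (- 2 - 2 * a) \in zideal p 2.
  move=> lt_p_m; have le_n : (p - 1 - m <= p./2)%N by lia.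
  have t'Z : - 1 - t \in Zloc p by rewrite rpredB ?rpredN ?rpred1.
  have a'E : - 1 - a = (p - 1 - m)%:R + p%:R * (- 1 - t).
    rewrite aE -subnDA natrB ?natrD; last by rewrite add1n.
    by ring.
  have := legendre_sum_lower p_pr p_odd pE le_n t'Z a'E.
  rewrite legendre_sumC (_ : 2 * (- 1 - a) = - 2 - 2 * a); last by ring.
  by move=> e; apply: eq_zideal e _; ring.
(* For m > p/2 the residue of 2a is the odd number 2m - p, with quotient u = 2t + 1. *)
have shift : (p < 2 * m)%N -> [/\ ((2 * m - p).+1 < p)%N,
    2 * a = (2 * m - p)%:R + p%:R * (2 * t + 1)
  & (- 1) ^+ (2 * m - p) = - 1 :> rat].
  move=> lt_p_m; split; first by lia.
    by rewrite natrB ?(ltnW lt_p_m) // natrM aE; ring.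
  by rewrite -signr_odd oddB ?(ltnW lt_p_m) // oddM p_odd.
split=> [/half' lt_m_p2|/half lt_p_m tN|/half lt_p_m tI].
- have le_m_n : (m <= p./2)%N by lia.
  by apply: eq_zideal (legendre_sum_lower p_pr p_odd pE le_m_n tZ aE) _; ring.
- have [s_lt xE sgn] := shift lt_p_m.
  have uN : 2 * t + 1 \notin zideal p 1.
    apply: contra tN => uI.
    apply: (eq_zideal (x := 2^-1 * (2 * t + 1))); last by field.
    apply: zidealMl => //; apply: Zloc_natV => //.
    by rewrite coprime_sym coprime2n.
  have u0 : 2 * t + 1 != 0 by apply: contraNneq uN => ->; rewrite rpred0.
  apply: (zideal_cancel p_pr uZ uN).
  have := pow2_sum_reflect p_pr p_odd s_lt uZ xE; rewrite sgn => eK.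
  (* Multiplied by u, the reflected congruence cancels the T(-2-2a) term of [eK]. *)
  have eD := zidealMl p_pr uZ (reflected lt_p_m).
  by apply: eq_zideal (rpredD eD eK) _ => //; field.
- have [s_lt xE sgn] := shift lt_p_m.
  have uI : 2 * t + 1 \in zideal p 1.
    apply: (eq_zideal (x := 2 * (t - - (1 / 2)))); last by field.
    by apply: zidealMl => //; apply: rpred_nat.
  have := pow2_sum_euler p_pr p_odd s_lt uI xE; rewrite sgn => eK.
  (* Now p(2t+1) is 0 modulo p^2; subtracting it replaces 2pt by -p once T(-2-2a) has cancelled. *)
  have Pu := zidealS p_pr uI.
  by apply: eq_zideal (rpredB (rpredD (reflected lt_p_m) eK) Pu) _ => //; ring.
Qed.
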